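(* Let $G$ be a compact abelian group, let $t_1,\dots,t_r\in G\setminus\{0\}$ and $D=\{t_1,\dots,t_r\}$. Suppose the lattice $\Lambda=\{n\in\mathbb{Z}^r: n_1t_1+\cdots+n_rt_r=0\}$ has rank $1$, and let $m=(m_1,\dots,m_r)\in\mathbb{Z}^r$ be a generator of $\Lambda$. Then, with $\|m\|_{\ell^1}=\sum_{i=1}^r|m_i|$, $$\mathrm{Md}_G(D)=\frac{\lfloor \|m\|_{\ell^1}/2\rfloor}{\|m\|_{\ell^1}}.$$
   Context: $\mu$ denotes the Haar probability measure on the compact (Hausdorff) abelian group $G$. The Motzkin density is $\mathrm{Md}_G(D)=\sup\{\mu(A): A\subset G \text{ Borel},\ (A-A)\cap D=\emptyset\}$. *)

(* Defs.v *)
From HB Require Import structures.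
From mathcomp Require Import all_boot all_order all_algebra.
From mathcomp Require Import all_classical all_reals all_analysis.
Set Implicit Arguments. Unset Strict Implicit. Unset Printing Implicit Defensive.
Import Order.TTheory GRing.Theory Num.Theory.
Local Open Scope classical_set_scope.
Local Open Scope ring_scope.

Definition borel (G : topologicalZmodType) : Type := G.

Section borel_instance.
Variable G : topologicalZmodType.
HB.instance Definition _ := Choice.on (borel G).
HB.instance Definition _ := isPointed.Build (borel G) (0 : G).

Lemma borel_setC (A : set G) : <<s @open G >> A -> <<s @open G >> (~` A).
Proof. by move=> sGA; rewrite -setTD; exact: sigma_algebraCD. Qed.

HB.instance Definition _ := @isMeasurable.Build (sigma_display (@open G))
  (borel G) <<s @open G >> (@sigma_algebra0 _ setT (@open G)) borel_setC
  (@sigma_algebra_bigcup _ setT (@open G)).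
End borel_instance.

Definition haar_probability (R : realType) (G : topologicalZmodType)
    (mu : probability (borel G) R) : Prop :=
  [/\ (forall (x : G) (A : set G), measurable (A : set (borel G)) ->
         mu ((fun y => x + y) @` A) = mu A),
      (forall A : set G, measurable (A : set (borel G)) ->
         mu A = ereal_inf [set mu U | U in [set U : set G | open U /\ A `<=` U]]) &
      (forall U : set G, open U ->
         mu U = ereal_sup [set mu K | K in [set K : set G | compact K /\ K `<=` U]])].

Definition motzkin_density (R : realType) (G : topologicalZmodType)
    (mu : probability (borel G) R) (D : set G) : \bar R :=
  ereal_sup [set mu A | A in [set A : set G |
     measurable (A : set (borel G)) /\
     (forall a b, A a -> A b -> ~ D (a - b))]].

(* Main.v *)
Require Import Defs.
From HB Require Import structures.
From mathcomp Require Import all_boot all_order all_algebra.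
From mathcomp Require Import all_fingroup.
From mathcomp Require Import all_classical all_reals all_analysis.
From mathcomp Require Import finmap ring zify.
Set Implicit Arguments.
Unset Strict Implicit.
Unset Printing Implicit Defensive.
Import Order.TTheory GRing.Theory Num.Theory.
Local Open Scope ring_scope.

(** Write [L] for the l1-norm of the generator [m], and call a set admissible
    when its differences avoid [D].

    Upper bound: the relation [\sum_i m i * t i = 0] is a closed walk of [L]
    steps [+- t i]. No translate of this walk has two cyclically consecutive
    vertices in an admissible set [A], hence at most [L./2] of its vertices lie
    in [A]; integrating over the translates gives [L * mu A <= L./2].

    Lower bound: let [I] be a finite admissible set and [F] a finite set
    containing [I], [I + D] and [I - D]. By compactness [G] has a finite Borel
    colouring that is injective on every translate of [F]. Given an ordering of
    the colours, keep [x] when the point of [x + F] with the least colour lies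
    in [x + I]; the kept points form an admissible Borel set. On average over
    the orderings, each [x] is kept with probability [#|I| / #|F|], so this
    ratio is a lower bound of the density.

    Let [cube N] be the image in [G] of the cube of side [2 N + 1] in [Z^r]. The
    level [\sum_i sgn (m i) * n i] of a point [\sum_i n i * t i] is well defined
    modulo [L] because [m] has level [L], and adding [t i] changes it by one.
    Hence, for each rotation of the cycle [Z/L], the points whose rotated level
    has an odd residue are admissible, and on average over the rotations they
    fill the proportion [L./2 / L] of [cube N]. The density is therefore at
    least [(L./2 / L) * (#|cube N| / #|cube N.+1|)] for all [N], and the ratio
    of cardinals gets arbitrarily close to 1 because [#|cube N|] is bounded by a
    polynomial in [N]. *)

Section sums_over_residues.

Lemma sum_cyclic_shift (L : nat) (f : nat -> nat) :
  f L = f 0%N -> (\sum_(j < L) f j.+1 = \sum_(j < L) f j)%N.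
Proof.
move=> fL; apply: (@addnI (f 0%N)).
by rewrite -(big_ord_recl L (fun j => f j)) big_ord_recr/= fL addnC.
Qed.

Lemma sum_cyclic_independent (L : nat) (b : nat -> bool) :
  b L = b 0%N -> (forall j, (j < L)%N -> ~~ (b j && b j.+1)) ->
  (\sum_(j < L) b j <= L./2)%N.
Proof.
move=> bL indep; rewrite geq_half_double -addnn.
rewrite -{2}(@sum_cyclic_shift L (fun j => b j)) ?bL// -big_split/=.
rewrite -[leqRHS]card_ord -sum1_card; apply: leq_sum => j _.
by have := indep j (ltn_ord j); do 2 case: (b _).
Qed.

Lemma sum_periodic (L : nat) (f : int -> nat) (z : int) :
  (forall u : int, f (u + L%:Z) = f u) ->
  (\sum_(c < L) f (z + c%:Z)%R = \sum_(c < L) f c%:Z)%N.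
Proof.
move=> f_periodic.
have sum_succ (u : int) :
    (\sum_(c < L) f (u + 1 + c%:Z)%R = \sum_(c < L) f (u + c%:Z)%R)%N.
  rewrite -(@sum_cyclic_shift L (fun c => f (u + c%:Z))) ?f_periodic ?addr0//.
  by apply: eq_bigr => c _; rewrite -addrA -PoszD add1n.
elim/int_rec: z => [|n IH|n IH].
- by apply: eq_bigr => c _; rewrite add0r.
- by rewrite -IH -[RHS]sum_succ -[in LHS]addn1.
- by rewrite -IH -[LHS]sum_succ -[in LHS]addn1 PoszD opprD addrNK.
Qed.

Lemma sum_odd (L : nat) : (\sum_(c < L) odd c = L./2)%N.
Proof.
elim: L => [|L IH]; first by rewrite big_ord0.
by rewrite big_ord_recr/= IH uphalf_half addnC.
Qed.

(* The odd residues form a maximum independent set of the cycle Z/L. *)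
Definition odd_residue (L : nat) (z : int) : bool := odd `|(z %% L)%Z|%N.

Lemma odd_residueMDl (L : nat) (k z : int) :
  odd_residue L (k * L + z) = odd_residue L z.
Proof. by rewrite /odd_residue modzMDl. Qed.

Lemma odd_residueD1 (L : nat) (z : int) : (0 < L)%N ->
  odd_residue L z -> ~~ odd_residue L (z + 1).
Proof.
move=> L_gt0; rewrite /odd_residue -modzDml.
have /gez0_abs <- : 0 <= (z %% L)%Z by rewrite modz_ge0// -lt0n.
have : (`|(z %% L)%Z| < L)%N by have := ltz_pmod z (_ : 0 < L%:Z); lia.
set k := absz _; rewrite absz_nat leq_eqVlt => /predU1P[kL _|kL].
  by rewrite -PoszD addn1 kL modzz.
by rewrite modz_small -PoszD addn1//= => ->.
Qed.

Lemma sum_odd_residue (L : nat) (z : int) :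
  (\sum_(c < L) odd_residue L (z + c%:Z)%R = L./2)%N.
Proof.
rewrite (sum_periodic (f := odd_residue L)) -?sum_odd => [|u].
  by apply: eq_bigr => c _; rewrite /odd_residue modz_small//= ltz_nat ltn_ord.
by rewrite -[X in u + X]mul1r addrC odd_residueMDl.
Qed.

End sums_over_residues.

Section perm_argmin.
Variables (T : finType) (K : nat).

Definition perm_argmin (f : T -> 'I_K) (a : T) : {set 'S_K} :=
  [set p : 'S_K | [forall b, (p (f a) <= p (f b))%N]].

Definition perm_argmin_in (f : T -> 'I_K) (S : {set T}) : {set 'S_K} :=
  \bigcup_(a in S) perm_argmin f a.

Variable f : T -> 'I_K.
Hypothesis f_inj : injective f.

Lemma perm_argmin_disjoint a b :
  a != b -> [disjoint perm_argmin f a & perm_argmin f b].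
Proof.
move=> ab; rewrite -setI_eq0; apply/eqP/setP => p; rewrite !inE.
apply/negP => /andP[/forallP/(_ b) pab /forallP/(_ a) pba].
move/eqP: ab; apply; apply/f_inj/(@perm_inj _ p)/val_inj/anti_leq.
by rewrite pab.
Qed.

Lemma card_perm_argminE a b : #|perm_argmin f a| = #|perm_argmin f b|.
Proof.
pose swap := tperm (f a) (f b).
rewrite -(card_preimset _ (mulgI swap)); apply: eq_card => p; rewrite !inE.
have swapE c : (swap * p)%g (f c) = p (f (tperm a b c)).
  by rewrite permM -inj_tperm.
apply/forallP/forallP => min_p c; have := min_p (tperm a b c).
  by rewrite !swapE tpermL tpermK.
by rewrite !swapE tpermL.
Qed.

Lemma perm_argmin_inT (a0 : T) : perm_argmin_in f [set: T] = [set: 'S_K].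
Proof.
apply/setP => p; rewrite inE; apply/bigcupP.
exists [arg min_(a < a0) p (f a)] => //; rewrite inE.
by case: arg_minnP => // a _ a_min; apply/forallP => b; exact: a_min.
Qed.

Lemma card_perm_argmin_in (S : {set T}) :
  (#|perm_argmin_in f S| * #|T| = #|S| * K`!)%N.
Proof.
have [->|[a0 _]] := set_0Vmem S.
  by rewrite /perm_argmin_in big_set0 !cards0.
have card_cover (S' : {set T}) : #|perm_argmin_in f S'| =
    (#|S'| * #|perm_argmin f a0|)%N.
  rewrite /perm_argmin_in big_mkcond/= -[LHS]sum1_card.
  rewrite partition_disjoint_bigcup => [|a b ab].
    rewrite -sum_nat_const [RHS]big_mkcond/=; apply: eq_bigr => a _.
    by rewrite sum1_card; case: ifP; rewrite ?cards0 ?(card_perm_argminE a a0).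
  by do 2 case: ifP => _; rewrite ?perm_argmin_disjoint//
    -setI_eq0 ?finset.setI0 ?finset.set0I.
have := card_cover [set: T]; rewrite (perm_argmin_inT a0) !cardsT card_Sn => ->.
by rewrite card_cover -mulnA [X in (_ * X)%N]mulnC.
Qed.

End perm_argmin.

Section polynomial_growth.
Variable R : realType.

Lemma poly_lt_exp (C rho : R) (r : nat) : 1 < rho ->
  exists N : nat, C * N.+1%:R ^+ r < rho ^+ N.
Proof.
move=> rho_gt1; pose x := ln rho; pose c : R := r.+1`!%:R.
have x_gt0 : 0 < x by rewrite ln_gt0.
have c_gt0 : 0 < c by rewrite ltr0n fact_gt0.
pose A := `|C| * 2 ^+ r * c / x ^+ r.+1.
pose N := (Num.truncn A).+1; exists N.
have exp_gt : (N%:R * x) ^+ r.+1 / c < rho ^+ N.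
  have -> : rho ^+ N = expR (N%:R * x).
    by rewrite expRM_natl lnK// posrE (lt_trans ltr01).
  apply: (lt_le_trans _ (expR_ge1Dxn r _)); first by rewrite ltrDr.
  by rewrite mulr_ge0// ltW.
apply: le_lt_trans exp_gt; rewrite ler_pdivlMr//.
apply: (@le_trans _ _ (`|C| * (2 * N%:R) ^+ r * c)).
  rewrite ler_pM2r//; apply: le_trans (ler_norm _) _.
  rewrite normrM ler_wpM2l// ger0_norm ?exprn_ge0//.
  by rewrite lerXn2r ?nnegrE// -natrM ler_nat; lia.
have -> : `|C| * (2 * N%:R) ^+ r * c = N%:R ^+ r * (A * x ^+ r.+1).
  by rewrite /A divfK ?expf_neq0 ?gt_eqF// exprMn; ring.
rewrite exprMn [N%:R ^+ r.+1]exprSr -[leRHS]mulrA ler_wpM2l ?exprn_ge0//.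
by rewrite ler_wpM2r ?exprn_ge0 ?ltW// truncnS_gt.
Qed.

Lemma le_of_poly_growth (f : nat -> R) (a b C : R) (r : nat) :
  0 < f 0%N -> (forall N, f N <= C * N.+1%:R ^+ r) -> 0 <= b ->
  (forall N, a * f N <= b * f N.+1) -> a <= b.
Proof.
move=> f0_gt0 f_poly b_ge0 f_step; rewrite leNgt; apply/negP => ba.
have a_gt0 : 0 < a by exact: le_lt_trans ba.
have [b_eq0|b_neq0] := eqVneq b 0.
  by have := f_step 0%N; rewrite b_eq0 mul0r pmulr_rle0// leNgt f0_gt0.
have b_gt0 : 0 < b by rewrite lt0r b_neq0.
have f_exp N : f 0%N * (a / b) ^+ N <= f N.
  elim: N => [|N IH]; first by rewrite mulr1.
  rewrite exprSr !mulrA ler_pdivrMr// [leRHS]mulrC (le_trans _ (f_step N))//.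
  by rewrite mulrC ler_pM2l.
have [|N] := @poly_lt_exp (C / f 0%N) (a / b) r.
  by rewrite ltr_pdivlMr ?mul1r.
rewrite mulrAC ltr_pdivrMr// [ltRHS]mulrC ltNge => /negP; apply.
exact: le_trans (f_exp N) (f_poly N).
Qed.

End polynomial_growth.

Local Open Scope classical_set_scope.

Section sum_probability.
Context d (T : measurableType d) (R : realType) (P : probability T R).
Variables (I : finType) (A : I -> set T).
Hypothesis mA : forall i, measurable (A i).

Let sum_indicE : (fun x => (\sum_i \1_(A i) x : R)%:E) =
  (fun x => \sum_i (\1_(A i) x)%:E)%E.
Proof. by apply/funext => x; rewrite sumEFin. Qed.

Lemma integrable_sum_indic :
  P.-integrable setT (fun x => (\sum_i \1_(A i) x : R)%:E).
Proof.
by rewrite sum_indicE; apply: integrable_sum => // i _; exact: integrable_indic.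
Qed.

Lemma integral_sum_indic :
  (\int[P]_x (\sum_i \1_(A i) x : R)%:E = (\sum_i fine (P (A i)))%:E)%E.
Proof.
rewrite sum_indicE integral_sum// => [|i]; last exact: integrable_indic.
rewrite -sumEFin; apply: eq_bigr => i _.
by rewrite integral_indic// setIT fineK// fin_num_measure.
Qed.

Let integral_probability_cst (k : R) : (\int[P]_x k%:E = k%:E)%E.
Proof. by rewrite integral_cst// [X in (_ * X)%E]probability_setT mule1. Qed.

Lemma sum_probability_le (k : R) :
  (forall x, \sum_i \1_(A i) x <= k) -> \sum_i fine (P (A i)) <= k.
Proof.
move=> count_le; rewrite -lee_fin -integral_sum_indic.
rewrite -integral_probability_cst.
apply: le_integral => // [||x _]; last by rewrite lee_fin.
- exact: integrable_sum_indic.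
- exact: finite_measure_integrable_cst.
Qed.

Lemma sum_probability_ge (k : R) :
  (forall x, k <= \sum_i \1_(A i) x) -> k <= \sum_i fine (P (A i)).
Proof.
move=> count_ge; rewrite -lee_fin -integral_sum_indic.
rewrite -integral_probability_cst.
apply: le_integral => // [||x _]; last by rewrite lee_fin.
- exact: finite_measure_integrable_cst.
- exact: integrable_sum_indic.
Qed.

End sum_probability.

Section finite_valued.
Context d (T : measurableType d).

Lemma measurable_preimage_fin (X : finType) (f : T -> X) (B : set X) :
  (forall y, measurable (f @^-1` [set y])) -> measurable (f @^-1` B).
Proof.
move=> mf; have -> : f @^-1` B = \bigcup_(y in B) f @^-1` [set y].
  apply/seteqP; split=> [x Bfx|x [y By /= fxy]]; first by exists (f x).
  by rewrite /preimage/= fxy.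
by apply: fin_bigcup_measurable => //; exact: finite_finset.
Qed.

Lemma measurable_finite_selection (K : nat) (A : nat -> set T) :
  (forall i, measurable (A i)) -> (forall x, exists2 i, (i < K)%N & A i x) ->
  exists l : T -> 'I_K,
    forall j, measurable (l @^-1` [set j]) /\ l @^-1` [set j] `<=` A j.
Proof.
move=> mA A_cover.
have /choice[l lA] x : exists j : 'I_K, seqDU A j x.
  have : (\big[setU/set0]_(i < K) A i) x.
    by rewrite -bigcup_mkord; have [i iK Aix] := A_cover x; exists i.
  rewrite bigsetU_seqDU -bigcup_mkord => -[i /= iK ix].
  by exists (Ordinal iK).
have lE j : l @^-1` [set j] = seqDU A j.
  apply/seteqP; split=> [x <-//|x jx]; apply/val_inj.
  by apply: (@trivIset_seqDU _ A) => //; exists x; split; first exact: lA.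
exists l => j; rewrite lE.
by split; [exact: seqDU_measurable|exact: subset_seqDU].
Qed.

End finite_valued.

Definition diff_avoiding (G : zmodType) (D A : set G) : Prop :=
  forall a b, A a -> A b -> ~ D (a - b).

Section topological_group.
Context (G : topologicalZmodType).
Implicit Types (g : G) (A E U : set G).

Lemma continuous_addr g : continuous (fun x : G => x + g).
Proof.
move=> x; apply: (@continuous_comp _ _ _ (fun x : G => (x, g))
  (fun z : G * G => z.1 + z.2)); last exact: add_continuous.
by apply: cvg_pair; [exact: cvg_id|exact: cvg_cst].
Qed.

Lemma open_addr g U : open U -> open [set x | U (x + g)].
Proof. by apply: open_comp => x _; exact: continuous_addr. Qed.

Lemma open_borel_measurable U : open U -> measurable (U : set (borel G)).
Proof. exact: sub_sigma_algebra. Qed.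

Lemma measurable_addr g A : measurable (A : set (borel G)) ->
  measurable ([set x | A (x + g)] : set (borel G)).
Proof.
have : measurable_fun setT (fun x : borel G => (x : G) + g : borel G).
  apply: (@measurability _ _ (borel G) (borel G) _ _ (@open G)) => //.
  move=> _ [U U_open <-].
  by rewrite setTI; apply: open_borel_measurable; exact: open_addr.
by move=> + mA => /(_ measurableT _ mA); rewrite setTI.
Qed.

Lemma nbhs0_diff_avoiding E : closed E -> ~ E 0 ->
  exists U, [/\ open U, U 0 & diff_avoiding E U].
Proof.
move=> E_closed E0.
have : nbhs ((0 : G) - 0) (~` E).
  by apply: open_nbhs_nbhs; rewrite subrr; split => //; exact: closed_openC.
move=> /(@sub_continuous G (0, 0))[[V W] /= [V0 W0] VW].
have : nbhs (0 : G) (V `&` W) by exact: filterI.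
rewrite nbhsE => -[U [U_open U0] UVW]; exists U; split => // a b Ua Ub.
by apply: (VW (a, b)); split => /=; [exact: (UVW a Ua).1|exact: (UVW b Ub).2].
Qed.

Lemma compact_translates_cover U : compact [set: G] -> open U -> U 0 ->
  exists s : seq G, forall x, exists2 i, (i < size s)%N & U (x + s`_i).
Proof.
(* Open covers are only available in pointed spaces. *)
pose pG : ptopologicalType := HB.pack G (isPointed.Build G 0).
rewrite (@compact_cover pG) => G_compact U_open U0.
have [g _|x _|D _ D_cover] := G_compact G setT (fun g => [set x | U (x + g)]).
- exact: open_addr.
- by exists (- x) => //=; rewrite subrr.
exists (finmap.enum_fset D) => x; have [g gD Uxg] := D_cover x I.
by exists (index g D); rewrite ?index_mem// nth_index.
Qed.

Lemma finite_borel_coloring E : compact [set: G] -> closed E -> ~ E 0 ->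
  exists K (l : G -> 'I_K), forall j,
    measurable (l @^-1` [set j] : set (borel G)) /\
    diff_avoiding E (l @^-1` [set j]).
Proof.
move=> G_compact E_closed E0.
have [U [U_open U0 U_avoid]] := nbhs0_diff_avoiding E_closed E0.
have [s s_cover] := compact_translates_cover G_compact U_open U0.
have [i|l lU] := @measurable_finite_selection _ (borel G) (size s)
    (fun i => [set x | U (x + s`_i)]) _ s_cover.
  by apply: open_borel_measurable; exact: open_addr.
exists (size s), l => j; have [ml l_sub] := lU j; split => // a b la lb.
have := U_avoid _ _ (l_sub a la) (l_sub b lb).
by rewrite [b + _]addrC addrKA.
Qed.

Lemma injective_borel_coloring (F : {fset G}) :
  compact [set: G] -> hausdorff_space G ->
  exists K (l : G -> 'I_K),
    (forall j, measurable (l @^-1` [set j] : set (borel G))) /\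
    (forall x, {in F &, injective (fun g => l (x + g))}).
Proof.
move=> G_compact G_hausdorff.
pose E := [set g - h | g in [set` F] & h in [set` F]] `\ (0 : G).
have E_closed : closed E.
  have /accessible_finite_set_closed := hausdorff_accessible G_hausdorff.
  apply; apply: finite_setD; exact: finite_image2.
have [|K [l lE]] := finite_borel_coloring G_compact E_closed.
  by move=> [_]; apply.
exists K, l; split=> [j|x g h gF hF lgh]; first exact: (lE j).1.
apply/eqP; rewrite -subr_eq0; apply/eqP; apply: contrapT => gh_neq0.
apply: ((lE (l (x + g))).2 (x + g) (x + h)) => //.
rewrite [x + g]addrC addrKA; split; last exact: gh_neq0.
by exists g => //; exists h.
Qed.

End topological_group.

Section motzkin_density.
Context (R : realType) (G : topologicalZmodType) (mu : probability (borel G) R).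
Variable D : set G.

Lemma motzkin_density_ge0 : (0 <= motzkin_density mu D)%E.
Proof. by apply: ereal_sup_ubound; exists set0; rewrite ?measure0. Qed.

Lemma motzkin_density_fin_num : motzkin_density mu D \is a fin_num.
Proof.
have le1 : (motzkin_density mu D <= 1)%E.
  by apply: ge_ereal_sup => _ [A [mA _] <-]; exact: probability_le1.
rewrite fin_numElt (lt_le_trans _ motzkin_density_ge0) ?ltNyr//.
exact: le_lt_trans le1 (ltry 1).
Qed.

Lemma le_motzkin_density (A : set G) : measurable (A : set (borel G)) ->
  diff_avoiding D A -> fine (mu A) <= fine (motzkin_density mu D).
Proof.
move=> mA A_avoid; apply: fine_le; rewrite ?motzkin_density_fin_num//.
  exact: fin_num_measure.
by apply: ereal_sup_ubound; exists A.
Qed.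

Lemma motzkin_density_le (c : R) :
  (forall A : set G, measurable (A : set (borel G)) -> diff_avoiding D A ->
    fine (mu A) <= c) ->
  fine (motzkin_density mu D) <= c.
Proof.
move=> mu_le; rewrite -lee_fin fineK ?motzkin_density_fin_num//.
apply: ge_ereal_sup => _ [A [mA A_avoid] <-].
by rewrite -[leLHS]fineK ?fin_num_measure// lee_fin mu_le.
Qed.

Lemma haar_measure_translate (g : G) (A : set G) : haar_probability mu ->
  measurable (A : set (borel G)) -> mu [set x | A (x + g)] = mu A.
Proof.
move=> [mu_inv _ _] mA; rewrite -(mu_inv (- g) A mA); congr (mu _).
apply/seteqP; split=> x /= => [Axg|[y Ay <-]].
  by exists (x + g) => //; rewrite addrC addrK.
by rewrite addrAC addNr add0r.
Qed.

Lemma motzkin_density_le_closed_walk (w : seq G) : haar_probability mu ->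
  (forall x, x \in w -> D x \/ D (- x)) -> \sum_(x <- w) x = 0 ->
  fine (motzkin_density mu D) * (size w)%:R <= (size w)./2%:R.
Proof.
move=> mu_haar w_steps w_closed.
have [->|w_gt0] := posnP (size w); first by rewrite mulr0.
rewrite -ler_pdivlMr ?ltr0n//; apply: motzkin_density_le => A mA A_avoid.
pose s j := \sum_(x <- take j w) x.
have s_step j : (j < size w)%N -> s j.+1 - s j = w`_j.
  move=> jw; rewrite /s (take_nth 0)// -cats1 big_cat/= big_seq1.
  by rewrite addrAC subrr add0r.
rewrite ler_pdivlMr ?ltr0n//.
have -> : fine (mu A) * (size w)%:R =
    \sum_(j < size w) fine (mu [set x | A (x + s j)]).
  under eq_bigr => j _ do rewrite (haar_measure_translate _ mu_haar mA).
  by rewrite sumr_const card_ord mulr_natr.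
apply: sum_probability_le => [j|x]; first exact: measurable_addr.
rewrite -natr_sum ler_nat.
apply: (@sum_cyclic_independent _ (fun j => x \in [set x | A (x + s j)])).
  by rewrite /s take_size take0 w_closed big_nil.
move=> j jw; apply/negP => /andP[/set_mem/= Aj /set_mem/= Aj1].
have [Dw|Dw] := w_steps _ (mem_nth 0 jw).
  by apply: (A_avoid _ _ Aj1 Aj); rewrite [x + _]addrC addrKA s_step.
apply: (A_avoid _ _ Aj Aj1).
by rewrite [x + _]addrC addrKA -opprB s_step.
Qed.

End motzkin_density.

Section argmin_set.
Context (G : topologicalZmodType) (I F : {fset G}) (K : nat) (l : G -> 'I_K).

Definition coloring_around (x : G) : {ffun F -> 'I_K} :=
  [ffun g => l (x + fsval g)].

Definition argmin_set (p : 'S_K) : set G :=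
  [set x | p \in perm_argmin_in (coloring_around x) (fsub F I)].

Lemma mem_argmin_set (p : 'S_K) (x : G) :
  (x \in argmin_set p) = (p \in perm_argmin_in (coloring_around x) (fsub F I)).
Proof. by apply/idP/idP; rewrite in_setE. Qed.

Lemma measurable_argmin_set (p : 'S_K) :
  (forall j, measurable (l @^-1` [set j] : set (borel G))) ->
  measurable (argmin_set p : set (borel G)).
Proof.
move=> ml; apply: (@measurable_preimage_fin _ (borel G) _ coloring_around
  [set c | p \in perm_argmin_in c (fsub F I)]) => c.
have -> : coloring_around @^-1` [set c] =
    \bigcap_(g in [set: F]) [set x | l (x + fsval g) = c g].
  apply/seteqP; split=> x /= => [<- g _ /=|xc]; first by rewrite ffunE.
  by apply/ffunP => g; rewrite ffunE; exact: xc.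
apply: fin_bigcap_measurable => [|g _]; first exact: finite_finset.
exact: (measurable_addr _ (ml (c g))).
Qed.

Lemma argmin_setP (p : 'S_K) (x : G) : argmin_set p x ->
  exists g : F, fsval g \in I /\
    forall h, h \in F -> (p (l (x + fsval g)%R) <= p (l (x + h)%R))%N.
Proof.
move=> /bigcupP[g]; rewrite in_fsub inE => gI /forallP g_min.
by exists g; split=> // h hF; have := g_min [` hF]%fset; rewrite !ffunE.
Qed.

Hypothesis l_inj : forall x, {in F &, injective (fun g => l (x + g))}.

Lemma sum_indic_argmin_set (R : realType) (x : G) : (I `<=` F)%fset ->
  (\sum_p \1_(argmin_set p) x) * #|` F|%:R = #|` I|%:R * K`!%:R :> R.
Proof.
move=> IF; rewrite -natr_sum -!natrM cardfE -(card_fsub IF); congr _%:R.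
rewrite -(@card_perm_argmin_in _ _ (coloring_around x)) => [|g h].
  rewrite -sum1_card [in RHS]big_mkcond/=; congr (_ * _)%N.
  by apply: eq_bigr => p _; rewrite mem_argmin_set; case: ifP.
by rewrite !ffunE => /l_inj gh; apply/val_inj/gh; exact: fsvalP.
Qed.

(* The minimisers seen from [a] and from [b] lie in each other's window, hence
   coincide as points of [G]. *)
Lemma diff_avoiding_argmin_set (D : set G) (p : 'S_K) :
  (forall g d, g \in I -> D d -> g + d \in F /\ g - d \in F) ->
  diff_avoiding D [set` I] -> diff_avoiding D (argmin_set p).
Proof.
move=> F_window I_avoid a b /argmin_setP[g [gI g_min]].
move=> /argmin_setP[h [hI h_min]] Dab.
have [gabF _] := F_window _ _ gI Dab; have [_ habF] := F_window _ _ hI Dab.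
have bgE : b + (fsval g + (a - b)) = a + fsval g.
  by rewrite addrC -addrA subrK addrC.
have ahE : a + (fsval h - (a - b)) = b + fsval h.
  by rewrite opprB addrCA [a + _]addrC subrK addrC.
have hgE : fsval h = fsval g + (a - b).
  apply: (@l_inj b) => //=; apply/(@perm_inj _ p)/val_inj/anti_leq.
  by rewrite h_min//= bgE -ahE g_min.
by apply: (I_avoid _ _ hI gI); rewrite hgE addrAC subrr add0r.
Qed.

End argmin_set.

Lemma card_le_motzkin_density (R : realType) (G : topologicalZmodType)
    (mu : probability (borel G) R) (D : set G) (I F : {fset G}) :
  compact [set: G] -> hausdorff_space G -> (I `<=` F)%fset ->
  (forall g d, g \in I -> D d -> g + d \in F /\ g - d \in F) ->
  diff_avoiding D [set` I] ->
  #|` I|%:R <= fine (motzkin_density mu D) * #|` F|%:R.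
Proof.
move=> G_compact G_hausdorff IF F_window I_avoid.
have [F_eq0|F_gt0] := posnP #|` F|.
  by move: (fsubset_leq_card IF); rewrite F_eq0 leqn0 mulr0 => /eqP->.
have [K [l [ml l_inj]]] := injective_borel_coloring F G_compact G_hausdorff.
have K_fact_gt0 : 0 < K`!%:R :> R by rewrite ltr0n fact_gt0.
have sum_le : \sum_p fine (mu (argmin_set I F l p)) <=
    K`!%:R * fine (motzkin_density mu D).
  rewrite mulr_natl -card_Sn -sumr_const; apply: ler_sum => p _.
  apply: le_motzkin_density; first exact: measurable_argmin_set.
  exact: diff_avoiding_argmin_set.
have sum_ge : #|` I|%:R * K`!%:R / #|` F|%:R <=
    \sum_p fine (mu (argmin_set I F l p)).
  apply: sum_probability_ge => [p|x]; first exact: measurable_argmin_set.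
  by rewrite ler_pdivrMr ?ltr0n// sum_indic_argmin_set.
have := le_trans sum_ge sum_le.
by rewrite ler_pdivrMr ?ltr0n// mulrC -mulrA ler_pM2l.
Qed.

Section int_comb.
Context (G : zmodType) (r : nat).
Implicit Types (t : 'I_r -> G) (n : 'I_r -> int).

Definition int_comb t n : G := \sum_(i < r) t i *~ n i.

Definition unit_vec (i : 'I_r) : 'I_r -> int := fun j => (j == i)%:Z.

Lemma int_comb_is_zmod_morphism t : zmod_morphism (int_comb t).
Proof.
move=> n n'; rewrite /int_comb -sumrB.
by apply: eq_bigr => i _; rewrite -mulrzBr.
Qed.

HB.instance Definition _ t := GRing.isZmodMorphism.Build ('I_r -> int) G
  (int_comb t) (int_comb_is_zmod_morphism t).

Lemma int_comb_unit_vec t i : int_comb t (unit_vec i) = t i.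
Proof.
rewrite /int_comb (bigD1 i)//= /unit_vec eqxx big1 ?addr0// => j ji.
by rewrite (negbTE ji).
Qed.

Lemma int_comb_walk t n : exists w : seq G,
  [/\ size w = (\sum_(i < r) `|n i|)%N, \sum_(x <- w) x = int_comb t n &
      forall x, x \in w -> range t x \/ range t (- x)].
Proof.
pose step i : G := t i *~ (-1) ^+ (n i < 0)%R.
exists (flatten [seq nseq `|n i|%N (step i) | i <- index_enum 'I_r]); split.
- rewrite size_flatten /shape -map_comp sumnE big_map.
  by apply: eq_bigr => i _; rewrite /= size_nseq.
- rewrite big_flatten big_map; apply: eq_bigr => i _.
  by rewrite big_nseq iter_addr_0 /step pmulrn -mulrzA -intEsign.
- move=> x /flatten_mapP[i _]; rewrite mem_nseq => /andP[_ /eqP->].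
  rewrite /step; case: (n i < 0); [right|left]; exists i => //.
  by rewrite mulrN1z opprK.
Qed.

End int_comb.

Section cube.
Context (G : zmodType) (r : nat) (t : 'I_r -> G).

Definition cube_vec (N : nat) (v : {ffun 'I_r -> 'I_(N.*2.+1)}) : 'I_r -> int :=
  fun i => (v i)%:Z - N%:Z.

Definition cube (N : nat) : {fset G} :=
  [fset int_comb t (cube_vec v) | v in {: {ffun 'I_r -> 'I_(N.*2.+1)}}]%fset.

Lemma cubeP (N : nat) (g : G) : reflect
  (exists2 n : 'I_r -> int, (forall i, `|n i| <= N%:Z) & g = int_comb t n)
  (g \in cube N).
Proof.
apply: (iffP (imfsetP _ _ _ _)) => /= [[v _ ->]|[n n_le ->]].
  exists (cube_vec v) => // i; rewrite /cube_vec.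
  by have := ltn_ord (v i); lia.
exists [ffun i => inord `|(n i + N%:Z)%R|%N] => //; congr int_comb.
by apply/funext => i; have ? := n_le i; rewrite /cube_vec ffunE inordK; lia.
Qed.

Lemma sub_cube (M N : nat) : (M <= N)%N -> (cube M `<=` cube N)%fset.
Proof.
move=> MN; apply/fsubsetP => g /cubeP[n n_le ->]; apply/cubeP; exists n => // i.
by have := n_le i; lia.
Qed.

Lemma cubeD (M N : nat) (g h : G) :
  g \in cube M -> h \in cube N -> g + h \in cube (M + N).
Proof.
move=> /cubeP[n n_le ->] /cubeP[n' n'_le ->]; rewrite -raddfD; apply/cubeP.
by exists (n + n') => // i; have := n_le i; have := n'_le i; rewrite fctE; lia.
Qed.

Lemma cubeN (N : nat) (g : G) : g \in cube N -> - g \in cube N.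
Proof.
move=> /cubeP[n n_le ->]; rewrite -raddfN; apply/cubeP.
by exists (- n) => // i; rewrite fctE normrN.
Qed.

Lemma range_sub_cube1 (d : G) : range t d -> d \in cube 1.
Proof.
move=> [i _ <-]; apply/cubeP; exists (unit_vec i); last first.
  by rewrite int_comb_unit_vec.
by move=> j; rewrite /unit_vec; case: (j == i).
Qed.

Lemma card_cube_le (N : nat) : (#|` cube N| <= N.*2.+1 ^ r)%N.
Proof.
apply: leq_trans (leq_imfset_card _ _ _) _.
by rewrite -cardE card_ffun !card_ord.
Qed.

Lemma card_cube_gt0 (N : nat) : (0 < #|` cube N|)%N.
Proof.
rewrite cardfs_gt0; apply/fset0Pn; exists 0; apply/cubeP.
by exists 0; rewrite ?raddf0.
Qed.

End cube.

Section cyclic_relations.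
Context (G : zmodType) (r : nat) (t : 'I_r -> G) (m : 'I_r -> int).
Hypothesis ker_int_comb : forall n : 'I_r -> int, int_comb t n = 0 ->
  exists k : int, forall i, n i = k * m i.

Let L := (\sum_(i < r) `|m i|)%N.

(* Unlike [sgz (m i)], the sign is 1 when [m i = 0], so that adding [t i] always
   changes the level by one. *)
Definition level : ('I_r -> int) -> int :=
  int_comb (fun i => (-1) ^+ (m i < 0)%R).

Lemma level_relation : level m = L.
Proof.
rewrite /level /int_comb /L (big_morph Posz PoszD (erefl _)).
by apply: eq_bigr => i _; rewrite mulrzz -normrEsign abszE.
Qed.

Lemma level_eq_mod (n n' : 'I_r -> int) : int_comb t n = int_comb t n' ->
  exists k : int, level n = k * L + level n'.
Proof.
move=> nn'; have [|k kE] := ker_int_comb (n := n - n').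
  by rewrite raddfB /= nn' subrr.
exists k; apply/eqP; rewrite -subr_eq; apply/eqP.
rewrite /level -raddfB /= -level_relation /level /int_comb mulr_sumr.
by apply: eq_bigr => i _; rewrite kE !mulrzz; ring.
Qed.

Definition odd_level (c : int) : set G :=
  [set int_comb t n | n in [set n | odd_residue L (level n + c)]].

Lemma mem_odd_level (c : int) (n : 'I_r -> int) :
  (int_comb t n \in odd_level c) = odd_residue L (level n + c).
Proof.
apply/idP/idP => [|odd_n]; last by apply/mem_set; exists n.
move=> /set_mem[n' /= + nn']; have [k ->] := level_eq_mod nn'.
by rewrite -addrA odd_residueMDl.
Qed.

Lemma diff_avoiding_odd_level (c : int) : (0 < L)%N ->
  diff_avoiding (range t) (odd_level c).
Proof.
move=> L_gt0 _ b [n /= odd_n <-] /mem_set b_odd [i _ ti].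
have bE : b = int_comb t (n - unit_vec i).
  by rewrite raddfB /= int_comb_unit_vec ti opprB addrC subrK.
move: b_odd; rewrite bE mem_odd_level /level raddfB /= int_comb_unit_vec.
rewrite -/(level n) addrAC; case: (m i < 0) => b_odd.
  by move: b_odd; rewrite opprK; apply/negP/odd_residueD1.
by have := odd_residueD1 L_gt0 b_odd; rewrite subrK odd_n.
Qed.

Definition odd_level_cube (N c : nat) : {fset G} :=
  [fset g in cube t N | g \in odd_level c]%fset.

Lemma sum_card_odd_level_cube (N : nat) :
  (\sum_(c < L) #|` odd_level_cube N c| = L./2 * #|` cube t N|)%N.
Proof.
have card_filter (c : 'I_L) : #|` odd_level_cube N c| =
    (\sum_(g <- cube t N) (g \in odd_level c))%N.
  rewrite card_fset_sum1 big_fset/= big_mkcond.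
  by apply: eq_bigr => g _; case: ifP.
rewrite (eq_bigr _ (fun c _ => card_filter c)) exchange_big/=.
rewrite card_fset_sum1 big_distrr/=; apply: eq_big_seq => _ /cubeP[n _ ->].
rewrite muln1 -(sum_odd_residue L (level n)).
by apply: eq_bigr => c _; rewrite mem_odd_level.
Qed.

End cyclic_relations.

Lemma motzkin_density_ge_half_l1 (R : realType) (G : topologicalZmodType)
    (mu : probability (borel G) R) (r : nat) (t : 'I_r -> G) (m : 'I_r -> int) :
  compact [set: G] -> hausdorff_space G ->
  (forall n : 'I_r -> int, int_comb t n = 0 ->
    exists k : int, forall i, n i = k * m i) ->
  let L := (\sum_(i < r) `|m i|)%N in (0 < L)%N ->
  L./2%:R <= fine (motzkin_density mu (range t)) * L%:R.
Proof.
move=> G_compact G_hausdorff ker_t L L_gt0; set md := fine _.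
have odd_level_cube_le N c :
    #|` odd_level_cube t m N c|%:R <= md * #|` cube t N.+1|%:R.
  apply: card_le_motzkin_density => //.
  - by apply: fsubset_trans (sub_cube t (leqnSn N)); exact: fset_sub.
  - move=> g d; rewrite !inE => /andP[gN _] /range_sub_cube1 d1.
    by rewrite -addn1 !cubeD ?cubeN.
  - move=> a b; rewrite /= !inE => /andP[_ /set_mem a_odd].
    move=> /andP[_ /set_mem b_odd].
    exact: (diff_avoiding_odd_level ker_t L_gt0 a_odd b_odd).
apply: (@le_of_poly_growth R (fun N => #|` cube t N|%:R) _ _ (2 ^+ r) r).
- by rewrite ltr0n card_cube_gt0.
- move=> N; rewrite -exprMn -natrM -natrX ler_nat.
  apply: leq_trans (card_cube_le t N) _.
  have [->|r_gt0] := posnP r; first by rewrite !expn0.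
  by rewrite leq_exp2r//; lia.
- by rewrite mulr_ge0// fine_ge0// motzkin_density_ge0.
move=> N; rewrite -natrM -(sum_card_odd_level_cube ker_t N) natr_sum -/L.
rewrite mulrAC mulr_natr -[X in _ *+ X]card_ord -sumr_const.
by apply: ler_sum => c _; exact: odd_level_cube_le.
Qed.

Theorem theorem1p2 (R : realType) (G : topologicalZmodType)
    (mu : probability (borel G) R)
    (Gcompact : compact [set: G]) (Ghausdorff : hausdorff_space G)
    (muHaar : haar_probability mu)
    (r : nat) (t : 'I_r -> G) (t_neq0 : forall i, t i != 0)
    (m : 'I_r -> int) (m_neq0 : exists i, m i != 0)
    (m_gen : forall n : 'I_r -> int,
        (\sum_(i < r) t i *~ n i = 0) <-> (exists k : int, forall i, n i = k * m i)) :
  let l1 := (\sum_(i < r) `|m i|)%N in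
  motzkin_density mu (range t) = ((l1./2)%:R / l1%:R : R)%:E.
Proof.
move=> l1; have [i mi_neq0] := m_neq0.
have l1_gt0 : (0 < l1)%N by rewrite /l1 (bigD1 i)//= addn_gt0 absz_gt0 mi_neq0.
have t_m : int_comb t m = 0 by apply/m_gen; exists 1 => j; rewrite mul1r.
have [w [w_size w_sum w_steps]] := int_comb_walk t m.
rewrite -(fineK (motzkin_density_fin_num mu _)); congr EFin.
apply/eqP; rewrite eq_le ler_pdivlMr ?ler_pdivrMr ?ltr0n//; apply/andP; split.
  rewrite /l1 -w_size; apply: motzkin_density_le_closed_walk => //.
  by rewrite w_sum.
by apply: motzkin_density_ge_half_l1 => // n /m_gen.
Qed.
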